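(* Let $(N,g,\xi,\eta,\varphi)$ be a normal almost contact metric manifold and let $c=\eta\wedge d\eta+d^{\varphi}F$. Then $(N,g,\xi,\eta,\varphi)$ is an ST manifold if and only if the map $\nabla\colon\Gamma(TN)\to\Gamma(TN)\otimes\Gamma(T^*N)$ defined by $$g(\nabla_XY,Z)=g(\nabla^{LC}_XY,Z)+\tfrac12c(X,Y,Z)$$ is an almost contact metric connection, i.e. a connection with $\nabla g=0$, $\nabla\xi=0$ and $\nabla\varphi=0$.
   Context: $\nabla^{LC}$ is the Levi-Civita connection of $g$. Convention: $d\eta(X,Y)=X\eta(Y)-Y\eta(X)-\eta([X,Y])$. An almost contact metric manifold $(N,g,\xi,\eta,\varphi)$ is an odd-dimensional Riemannian manifold $(N,g)$ with a unit-norm vector field $\xi$, its dual $1$-form $\eta=g(\xi,\cdot)$, and a bundle endomorphism $\varphi\colon TN\to TN$ such that $\varphi(\xi)=0$, $\varphi^2=-1+\eta\otimes\xi$, and $g(\varphi(X),\varphi(Y))=g(X,Y)-\eta(X)\eta(Y)$. It is normal if, for all vector fields $X,Y$, $$S(X,Y)=[\varphi(X),\varphi(Y)]+\varphi^2[X,Y]-\varphi[\varphi(X),Y]-\varphi[X,\varphi(Y)]+d\eta(X,Y)\xi=0.$$ The fundamental $2$-form is $F=g(\varphi\cdot,\cdot)$. For a form $\alpha$, $d^{\varphi}\alpha=d\alpha(\varphi\cdot,\dots,\varphi\cdot)$. An ST (Sasaki with torsion) manifold is a normal almost contact metric manifold such that $\xi$ is a Killing vector field. *)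

(* Defs.v *)
From HB Require Import structures.
From mathcomp Require Import all_boot all_order all_algebra.
From mathcomp Require Import all_classical all_reals all_analysis.
From mathcomp Require Import ring.
Import Order.TTheory GRing.Theory Num.Theory.
Import numFieldNormedType.Exports.

Set Implicit Arguments.
Unset Strict Implicit.
Unset Printing Implicit Defensive.

Local Open Scope classical_set_scope.
Local Open Scope ring_scope.

Section Ck.
Context {R : realType} {n : nat} {W : normedModType R}.

Fixpoint Ck (k : nat) (U : set 'rV[R]_n) (f : 'rV[R]_n -> W) : Prop :=
  {within U, continuous f} /\
  (if k is k'.+1 then
     forall i : 'I_n, (forall x, U x -> derivable f x 'e_i) /\ Ck k' U ('D_'e_i f)
   else True).

Definition smooth_on (U : set 'rV[R]_n) (f : 'rV[R]_n -> W) : Prop :=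
  forall k, Ck k U f.

End Ck.

Section CkTheory.
Context {R : realType} {n : nat}.
Implicit Types (U : set 'rV[R]_n) (f g : 'rV[R]_n -> R).

Lemma CkW k U f : Ck k.+1 U f -> Ck k U f.
Proof.
elim: k f => [|k IH] f [cf df]; first by split.
split=> // i; have [dfi Cdf] := df i.
by split=> //; apply: IH.
Qed.

Lemma eq_Ck k U f g : open U -> {in U, f =1 g} -> Ck k U f -> Ck k U g.
Proof.
move=> oU; elim: k f g => [|k IH] f g fg [cf df].
  split=> //; exact: (subspace_eq_continuous fg).
split=> [|i]; first exact: (subspace_eq_continuous fg).
have [dfi Cdf] := df i.
have nfg x : U x -> {near x, f =1 g}.
  move=> Ux; have : nbhs x U by exact: open_nbhs_nbhs.
  by apply: filterS => y Uy; apply: fg; rewrite inE.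
split=> [x Ux|]; first exact: near_eq_derivable (nfg _ Ux) (dfi _ Ux).
by apply: IH Cdf => x; rewrite inE => Ux; exact: near_eq_derive (nfg _ Ux).
Qed.

Lemma Ck_cst k U (a : R) : Ck k U (fun=> a).
Proof.
elim: k a => [|k IH] a; first by split=> //; exact: cst_continuous.
split=> [|i]; first exact: cst_continuous.
split=> [x Ux|]; first exact: derivable_cst.
have -> : (fun x : 'rV[R]_n => 'D_'e_i (fun=> a) x) = (fun=> 0).
  by apply/funext => x; rewrite derive_cst.
exact: IH.
Qed.

Lemma CkD k U f g : open U -> Ck k U f -> Ck k U g ->
  Ck k U (fun x => f x + g x).
Proof.
move=> oU; elim: k f g => [|k IH] f g [cf df] [cg dg].
  by split=> // x; apply: continuousD; [exact: cf|exact: cg].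
split=> [x|i]; first by apply: continuousD; [exact: cf|exact: cg].
have [dfi Cdf] := df i; have [dgi Cdg] := dg i.
split=> [x Ux|]; first by apply: derivableD; [exact: dfi|exact: dgi].
apply: (eq_Ck oU _ (IH _ _ Cdf Cdg)) => x; rewrite inE => Ux.
by apply/esym; exact: deriveD (dfi _ Ux) (dgi _ Ux).
Qed.

Lemma CkM k U f g : open U -> Ck k U f -> Ck k U g ->
  Ck k U (fun x => f x * g x).
Proof.
move=> oU; elim: k f g => [|k IH] f g Cf Cg.
  have [cf _] := Cf; have [cg _] := Cg.
  by split=> // x; apply: continuousM; [exact: cf|exact: cg].
have [cf df] := Cf; have [cg dg] := Cg.
split=> [x|i]; first by apply: continuousM; [exact: cf|exact: cg].
have [dfi Cdf] := df i; have [dgi Cdg] := dg i.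
split=> [x Ux|]; first by apply: derivableM; [exact: dfi|exact: dgi].
apply: (eq_Ck oU _ (CkD oU (IH _ _ (CkW Cf) Cdg) (IH _ _ (CkW Cg) Cdf))) => x.
rewrite inE => Ux.
by apply/esym; exact: deriveM (dfi _ Ux) (dgi _ Ux).
Qed.

End CkTheory.

Record chart (R : realType) (n : nat) (N : topologicalType) := Chart {
  chart_dom : set N ;
  chart_map : N -> 'rV[R]_n ;
  chart_inv : 'rV[R]_n -> N ;
  chart_dom_open : open chart_dom ;
  chart_cod_open : open (chart_map @` chart_dom) ;
  chart_mapK : {in chart_dom, cancel chart_map chart_inv} ;
  chart_map_continuous : {within chart_dom, continuous chart_map} ;
  chart_inv_continuous :
    {within chart_map @` chart_dom, continuous chart_inv} }.

Definition compatible_charts (R : realType) (n : nat) (N : topologicalType)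
    (c1 c2 : chart R n N) : Prop :=
  smooth_on (chart_map c1 @` (chart_dom c1 `&` chart_dom c2))
    (chart_map c2 \o chart_inv c1).

Record smooth_manifold (R : realType) (n : nat) := SmoothManifold {
  manifold_space :> topologicalType ;
  manifold_hausdorff : hausdorff_space manifold_space ;
  manifold_second_countable : @second_countable manifold_space ;
  atlas : set (chart R n manifold_space) ;
  atlas_cover : forall p, exists2 c, atlas c & chart_dom c p ;
  atlas_compatible : forall c1 c2, atlas c1 -> atlas c2 ->
    compatible_charts c1 c2 }.

Section SmoothFunctions.
Context {R : realType} {n : nat} (N : smooth_manifold R n).

Definition is_smooth (f : N -> R) : Prop :=
  forall c, atlas c ->
    smooth_on (chart_map c @` chart_dom c) (f \o chart_inv c).

Definition smooth_pred : {pred N -> R} := fun f => `[< is_smooth f >].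

Lemma smooth_predP (f : N -> R) : reflect (is_smooth f) (f \in smooth_pred).
Proof. exact: asboolP. Qed.

Lemma smooth_cst (a : R) : is_smooth (fun=> a).
Proof. by move=> c _ k; exact: Ck_cst. Qed.

Lemma smoothD (f g : N -> R) :
  is_smooth f -> is_smooth g -> is_smooth (fun p => f p + g p).
Proof.
move=> sf sg c ac k.
by apply: CkD; [exact: chart_cod_open|exact: sf|exact: sg].
Qed.

Lemma smoothM (f g : N -> R) :
  is_smooth f -> is_smooth g -> is_smooth (fun p => f p * g p).
Proof.
move=> sf sg c ac k.
by apply: CkM; [exact: chart_cod_open|exact: sf|exact: sg].
Qed.

Lemma smoothZ (a : R) (f : N -> R) : is_smooth f -> is_smooth (fun p => a * f p).
Proof. by move=> sf; apply: smoothM => //; exact: smooth_cst. Qed.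

Lemma smooth_pred_submod_closed : submod_closed smooth_pred.
Proof.
split; first by apply/smooth_predP; exact: smooth_cst.
move=> a f g /smooth_predP sf /smooth_predP sg; apply/smooth_predP.
by apply: smoothD => //; exact: smoothZ.
Qed.

Lemma smooth_pred_mulr_closed : mulr_closed smooth_pred.
Proof.
split; first by apply/smooth_predP; exact: smooth_cst.
move=> f g /smooth_predP sf /smooth_predP sg; apply/smooth_predP.
exact: smoothM.
Qed.

HB.instance Definition _ :=
  GRing.isSubmodClosed.Build _ _ smooth_pred smooth_pred_submod_closed.
HB.instance Definition _ :=
  GRing.isMulClosed.Build _ smooth_pred smooth_pred_mulr_closed.

Record smooth_fun := SmoothFun {
  smooth_val :> N -> R ;
  _ : smooth_val \in smooth_pred }.

HB.instance Definition _ := [isSub for smooth_val].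
HB.instance Definition _ := [Choice of smooth_fun by <:].
HB.instance Definition _ := [SubChoice_isSubZmodule of smooth_fun by <:].
HB.instance Definition _ := [SubZmodule_isSubLmodule of smooth_fun by <:].
HB.instance Definition _ :=
  GRing.SubZmodule_isSubPzRing.Build _ _ smooth_fun (subringClosedP _).
HB.instance Definition _ :=
  GRing.SubPzRing_isSubComPzRing.Build _ _ smooth_fun.

End SmoothFunctions.

Section TangentSpace.
Context {R : realType} {n : nat} {N : smooth_manifold R n} (p : N).

Definition is_derivation_at (v : smooth_fun N -> R) : Prop :=
  scalar v /\ (forall f g, v (f * g) = f p * v g + g p * v f).

Definition derivation_pred : {pred smooth_fun N -> R} :=
  fun v => `[< is_derivation_at v >].

Lemma derivation_predP (v : smooth_fun N -> R) :
  reflect (is_derivation_at v) (v \in derivation_pred).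
Proof. exact: asboolP. Qed.

Lemma derivation_pred_submod_closed : submod_closed derivation_pred.
Proof.
split.
  apply/derivation_predP; split=> [a f g|f g] /=.
    by rewrite -[LHS]/(0 : R) -[RHS]/(a * 0 + 0 : R) mulr0 addr0.
  by rewrite -[LHS]/(0 : R) -[RHS]/(f p * 0 + g p * 0 : R) !mulr0 addr0.
move=> a v w /derivation_predP[vl vM] /derivation_predP[wl wM].
apply/derivation_predP; split=> [b f g|f g] /=.
  rewrite -[LHS]/(a * v (b *: f + g) + w (b *: f + g)).
  rewrite -[RHS]/(b * (a * v f + w f) + (a * v g + w g)) vl wl /=.
  by rewrite !mulrDr addrACA mulrCA.
rewrite -[LHS]/(a * v (f * g) + w (f * g)).
rewrite -[RHS]/(f p * (a * v g + w g) + g p * (a * v f + w f)) vM wM.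
by rewrite !mulrDr addrACA (mulrCA a) (mulrCA a).
Qed.

HB.instance Definition _ :=
  GRing.isSubmodClosed.Build _ _ derivation_pred derivation_pred_submod_closed.

Record tangent := Tangent {
  tangent_val :> smooth_fun N -> R ;
  _ : tangent_val \in derivation_pred }.

HB.instance Definition _ := [isSub for tangent_val].
HB.instance Definition _ := [Choice of tangent by <:].
HB.instance Definition _ := [SubChoice_isSubZmodule of tangent by <:].
HB.instance Definition _ := [SubZmodule_isSubLmodule of tangent by <:].

Lemma tangent_is_derivation (v : tangent) : is_derivation_at v.
Proof. by case: v => v dv; exact/derivation_predP. Qed.

End TangentSpace.

Section VectorFields.
Context {R : realType} {n : nat} (N : smooth_manifold R n).

Record vector_field := VectorField {
  vf_at :> forall p : N, tangent p ;
  vf_smooth : forall f : smooth_fun N, is_smooth (fun p => vf_at p f) }.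

HB.instance Definition _ := gen_eqMixin vector_field.
HB.instance Definition _ := gen_choiceMixin vector_field.

Lemma vector_fieldP (X Y : vector_field) : (forall p, X p = Y p) -> X = Y.
Proof.
case: X Y => [X sX] [Y sY] /= XY.
have eXY : X = Y by apply: functional_extensionality_dep.
by case: Y / eXY sY {XY} => sY; congr VectorField; exact: Prop_irrelevance.
Qed.

Let add_subproof (X Y : vector_field) (f : smooth_fun N) :
  is_smooth (fun p => (X p + Y p) f).
Proof. by apply: smoothD; exact: vf_smooth. Qed.

Let zero_subproof (f : smooth_fun N) :
  is_smooth (fun p => (0 : tangent p) f).
Proof. exact: smooth_cst. Qed.

Lemma smooth_funP (f : smooth_fun N) : is_smooth f.
Proof. by case: f => f sf; exact/smooth_predP. Qed.

Let scale_subproof (h : smooth_fun N) (X : vector_field) (f : smooth_fun N) :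
  is_smooth (fun p => (h p *: X p) f).
Proof. by apply: smoothM; [exact: smooth_funP|exact: vf_smooth]. Qed.

Let opp_subproof (X : vector_field) (f : smooth_fun N) :
  is_smooth (fun p => (- X p) f).
Proof.
have -> : (fun p => (- X p) f) = (fun p => -1 * X p f) :> (N -> R).
  by apply/funext => p; rewrite mulN1r.
by apply: smoothZ; exact: vf_smooth.
Qed.

Definition vf_add X Y := VectorField (add_subproof X Y).
Definition vf_zero := VectorField zero_subproof.
Definition vf_opp X := VectorField (opp_subproof X).
Definition vf_scale h X := VectorField (scale_subproof h X).

Let vf_addA : associative vf_add.
Proof. by move=> X Y Z; apply: vector_fieldP => p /=; rewrite addrA. Qed.
Let vf_addC : commutative vf_add.
Proof. by move=> X Y; apply: vector_fieldP => p /=; rewrite addrC. Qed.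
Let vf_add0 : left_id vf_zero vf_add.
Proof. by move=> X; apply: vector_fieldP => p /=; rewrite add0r. Qed.
Let vf_addN : left_inverse vf_zero vf_opp vf_add.
Proof. by move=> X; apply: vector_fieldP => p /=; rewrite addNr. Qed.

HB.instance Definition _ :=
  GRing.isZmodule.Build vector_field vf_addA vf_addC vf_add0 vf_addN.

Let vf_scaleA a b X : vf_scale a (vf_scale b X) = vf_scale (a * b) X.
Proof. by apply: vector_fieldP => p /=; rewrite scalerA. Qed.
Let vf_scale1 : left_id 1 vf_scale.
Proof. by move=> X; apply: vector_fieldP => p /=; rewrite scale1r. Qed.
Let vf_scaleDr : right_distributive vf_scale +%R.
Proof. by move=> a X Y; apply: vector_fieldP => p /=; rewrite scalerDr. Qed.
Let vf_scaleDl X : {morph vf_scale^~ X : a b / a + b}.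
Proof. by move=> a b; apply: vector_fieldP => p /=; rewrite scalerDl. Qed.

HB.instance Definition _ := GRing.Zmodule_isLmodule.Build (smooth_fun N)
  vector_field vf_scaleA vf_scale1 vf_scaleDr vf_scaleDl.

Definition mk_smooth_fun (f : N -> R) (sf : is_smooth f) : smooth_fun N :=
  @SmoothFun R n N f (introT (smooth_predP f) sf).

Definition lie_fun (X : vector_field) (f : smooth_fun N) : smooth_fun N :=
  mk_smooth_fun (vf_smooth X f).

Lemma lie_fun_linear (X : vector_field) (a : R) (f g : smooth_fun N) :
  lie_fun X (a *: f + g) = a *: lie_fun X f + lie_fun X g.
Proof.
apply/val_inj/funext => p /=; have [Xl _] := tangent_is_derivation (X p).
by rewrite Xl.
Qed.

Lemma lie_funM (X : vector_field) (f g : smooth_fun N) :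
  lie_fun X (f * g) = f * lie_fun X g + g * lie_fun X f.
Proof.
apply/val_inj/funext => p /=; have [_ XM] := tangent_is_derivation (X p).
by rewrite XM.
Qed.

Let bracket_derivation (X Y : vector_field) (p : N) :
  (fun f : smooth_fun N => X p (lie_fun Y f) - Y p (lie_fun X f) : R)
    \in derivation_pred p.
Proof.
have [Xl XM] := tangent_is_derivation (X p).
have [Yl YM] := tangent_is_derivation (Y p).
have XD f g : X p (f + g) = X p f + X p g.
  by rewrite -[f]scale1r Xl /= mul1r scale1r.
have YD f g : Y p (f + g) = Y p f + Y p g.
  by rewrite -[f]scale1r Yl /= mul1r scale1r.
apply/derivation_predP; split=> [a f g|f g] /=.
  by rewrite !lie_fun_linear Xl Yl /= mulrBr opprD addrACA.
rewrite !lie_funM XD YD !XM !YM /=.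
have E (a b x y z w u v c d : R) :
    a * x + c * z + (b * y + d * w) - (a * u + w * d + (b * v + z * c)) =
    a * (x - u) + b * (y - v) by ring.
exact: E.
Qed.

Let bracket_smooth (X Y : vector_field) (f : smooth_fun N) :
  is_smooth (fun p => Tangent (bracket_derivation X Y p) f).
Proof.
have -> : (fun p => Tangent (bracket_derivation X Y p) f) =
    (fun p => lie_fun X (lie_fun Y f) p + (-1) * lie_fun Y (lie_fun X f) p)
    :> (N -> R).
  by apply/funext => p /=; rewrite mulN1r.
by apply: smoothD; [|apply: smoothZ]; exact: smooth_funP.
Qed.

Definition lie_bracket (X Y : vector_field) : vector_field :=
  VectorField (bracket_smooth X Y).

End VectorFields.

(* Tensor fields are families of multilinear maps on the tangent spaces.  They
   are smooth when they take smooth vector fields to smooth functions or smooth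
   vector fields; on a Hausdorff second countable manifold, testing on global
   vector fields amounts to testing in charts. *)

Section TensorFields.
Context {R : realType} {n : nat} (N : smooth_manifold R n).

Record one_form := OneForm {
  form_at : forall p : N, tangent p -> R ;
  form_linear : forall p, scalar (@form_at p) ;
  form_smooth : forall X : vector_field N,
    is_smooth (fun p => form_at (X p)) }.

Definition form_app (a : one_form) (X : vector_field N) : smooth_fun N :=
  mk_smooth_fun (form_smooth a X).

Record bundle_endomorphism := BundleEndomorphism {
  endo_at : forall p : N, tangent p -> tangent p ;
  endo_linear : forall p, linear (@endo_at p) ;
  endo_smooth : forall (X : vector_field N) (f : smooth_fun N),
    is_smooth (fun p => endo_at (X p) f) }.

Definition endo_app (A : bundle_endomorphism) (X : vector_field N) :
    vector_field N :=
  VectorField (endo_smooth A X).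

Record riemannian_metric := RiemannianMetric {
  metric_at : forall p : N, tangent p -> tangent p -> R ;
  metric_linear : forall p v, scalar ((@metric_at p)^~ v) ;
  metric_sym : forall p (u v : tangent p), metric_at u v = metric_at v u ;
  metric_pos : forall p (v : tangent p), v != 0 -> 0 < metric_at v v ;
  metric_smooth : forall X Y : vector_field N,
    is_smooth (fun p => metric_at (X p) (Y p)) }.

Definition metric_app (g : riemannian_metric) (X Y : vector_field N) :
    smooth_fun N :=
  mk_smooth_fun (metric_smooth g X Y).

End TensorFields.

Coercion form_app : one_form >-> Funclass.
Coercion endo_app : bundle_endomorphism >-> Funclass.
Coercion metric_app : riemannian_metric >-> Funclass.

(* Differential k-forms, seen as functions of k vector fields.  The exterior
   derivative and the wedge product carry no factor 1/2 or 1/3. *)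

Section Forms.
Context {R : realType} {n : nat} {N : smooth_manifold R n}.
Implicit Types X Y Z : vector_field N.

Definition ext_d1 (a : vector_field N -> smooth_fun N) X Y : smooth_fun N :=
  lie_fun X (a Y) - lie_fun Y (a X) - a (lie_bracket X Y).

Definition ext_d2 (w : vector_field N -> vector_field N -> smooth_fun N)
    X Y Z : smooth_fun N :=
  lie_fun X (w Y Z) - lie_fun Y (w X Z) + lie_fun Z (w X Y)
  - w (lie_bracket X Y) Z + w (lie_bracket X Z) Y - w (lie_bracket Y Z) X.

Definition wedge12 (a : vector_field N -> smooth_fun N)
    (w : vector_field N -> vector_field N -> smooth_fun N)
    X Y Z : smooth_fun N :=
  a X * w Y Z - a Y * w X Z + a Z * w X Y.

Definition ext_dphi2 (phi : bundle_endomorphism N)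
    (w : vector_field N -> vector_field N -> smooth_fun N)
    X Y Z : smooth_fun N :=
  ext_d2 w (phi X) (phi Y) (phi Z).

End Forms.

Section Connections.
Context {R : realType} {n : nat} {N : smooth_manifold R n}.
Implicit Types (X Y Z : vector_field N) (g : riemannian_metric N).
Implicit Types nabla : vector_field N -> vector_field N -> vector_field N.

(* Linearity over R in the second argument is the Leibniz rule for constant
   functions. *)
Definition is_connection nabla : Prop :=
  [/\ forall Y, linear (nabla ^~ Y),
      forall X, {morph nabla X : Y Z / Y + Z} &
      forall X (f : smooth_fun N) Y,
        nabla X (f *: Y) = lie_fun X f *: Y + f *: nabla X Y].

Definition cov_metric nabla g X Y Z : smooth_fun N :=
  lie_fun X (g Y Z) - g (nabla X Y) Z - g Y (nabla X Z).

Definition cov_endo nabla (A : bundle_endomorphism N) X Y : vector_field N :=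
  nabla X (A Y) - A (nabla X Y).

Definition torsion nabla X Y : vector_field N :=
  nabla X Y - nabla Y X - lie_bracket X Y.

Definition is_levi_civita g nabla : Prop :=
  [/\ is_connection nabla,
      forall X Y Z, cov_metric nabla g X Y Z = 0 &
      forall X Y, torsion nabla X Y = 0].

Definition lie_metric g X Y Z : smooth_fun N :=
  lie_fun X (g Y Z) - g (lie_bracket X Y) Z - g Y (lie_bracket X Z).

Definition is_killing g X : Prop := forall Y Z, lie_metric g X Y Z = 0.

End Connections.

Section AlmostContactMetric.
Context {R : realType} {n : nat} {N : smooth_manifold R n}.
Variables (g : riemannian_metric N) (xi : vector_field N).
Variables (eta : one_form N) (phi : bundle_endomorphism N).
Implicit Types X Y Z : vector_field N.

Record almost_contact_metric : Prop := AlmostContactMetric {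
  acm_odd : odd n ;
  acm_unit : forall p, metric_at g (xi p) (xi p) = 1 ;
  acm_dual : forall p (v : tangent p), form_at eta v = metric_at g (xi p) v ;
  acm_phi_xi : forall p, endo_at phi (xi p) = 0 ;
  acm_phi2 : forall p (v : tangent p),
    endo_at phi (endo_at phi v) = - v + form_at eta v *: xi p ;
  acm_compat : forall p (u v : tangent p),
    metric_at g (endo_at phi u) (endo_at phi v) =
    metric_at g u v - form_at eta u * form_at eta v }.

Definition normality_tensor X Y : vector_field N :=
  lie_bracket (phi X) (phi Y) + phi (phi (lie_bracket X Y))
  - phi (lie_bracket (phi X) Y) - phi (lie_bracket X (phi Y))
  + ext_d1 eta X Y *: xi.

Definition normal_acm : Prop :=
  almost_contact_metric /\ forall X Y, normality_tensor X Y = 0.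

Definition ST_manifold : Prop := normal_acm /\ is_killing g xi.

Definition fundamental_form X Y : smooth_fun N := g (phi X) Y.

Definition torsion_form X Y Z : smooth_fun N :=
  wedge12 eta (ext_d1 eta) X Y Z + ext_dphi2 phi fundamental_form X Y Z.

Definition acm_connection
    (nabla : vector_field N -> vector_field N -> vector_field N) : Prop :=
  [/\ is_connection nabla,
      forall X Y Z, cov_metric nabla g X Y Z = 0,
      forall X, nabla X xi = 0 &
      forall X Y, cov_endo nabla phi X Y = 0].

End AlmostContactMetric.

(* Main.v *)
(* Put A(X,Y,Z) = g((D_X phi)Y, Z) and B(X,Y) = g(D_X xi, Y), with D the
   Levi-Civita connection.  As D is torsion-free, both the normality tensor and
   c = eta /\ d eta + d^phi F are linear combinations of A, B and eta.  If
   xi is Killing, i.e. B is skew, normality together with the derivative of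
   phi^2 = -1 + eta (x) xi yields
     A(phi X, Y, Z) + A(X, Y, phi Z) = - B(X, Y) eta(Z),
   and expanding c with this identity gives nabla phi = 0.  Conversely,
   nabla xi = 0 means B(X,Z) = -c(X,xi,Z)/2, which is skew since c is a
   3-form, so xi is Killing. *)

Require Import Defs.
From HB Require Import structures.
From mathcomp Require Import all_boot all_order all_algebra.
From mathcomp Require Import all_classical all_reals all_analysis.
From mathcomp Require Import ring lra.
Import Order.TTheory GRing.Theory Num.Theory.
Local Open Scope ring_scope.

(** * Pointwise algebra of A, B, eta and phi when B is skew *)

Section NormalTensorAlgebra.
Context {K : realFieldType} {V : Type}.
Variables (A : V -> V -> V -> K) (B : V -> V -> K) (eta : V -> K).
Variables (phi : V -> V) (xi : V).

(** This is c with d eta(X,Y) written as B(X,Y) - B(Y,X) and dF as the cyclic sum of A. As [V]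
    carries no linear structure, linearity enters through hypotheses such as [A_phi2_1]. *)
Definition torsion_tensor X Y Z : K :=
  eta X * (B Y Z - B Z Y) - eta Y * (B X Z - B Z X)
  + eta Z * (B X Y - B Y X)
  + (A (phi X) (phi Y) (phi Z) + A (phi Y) (phi Z) (phi X)
     + A (phi Z) (phi X) (phi Y)).

Hypothesis eta_xi : eta xi = 1.
Hypothesis eta_phi : forall X, eta (phi X) = 0.
Hypothesis A_skew : forall X Y Z, A X Y Z = - A X Z Y.
Hypothesis A_phi_xi1 : forall Y Z, A (phi xi) Y Z = 0.
Hypothesis A_phi_xi3 : forall X Y, A X Y (phi xi) = 0.
Hypothesis A_xi : forall X Z, A X xi Z = B X (phi Z).
Hypothesis A_phi2_1 : forall X Y Z,
  A (phi (phi X)) Y Z = - A X Y Z + eta X * A xi Y Z.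
Hypothesis A_phi2_3 : forall X Y Z,
  A X Y (phi (phi Z)) = - A X Y Z + eta Z * A X Y xi.
Hypothesis B_xi : forall X, B X xi = 0.
Hypothesis B_phi2 : forall X Z, B X (phi (phi Z)) = - B X Z + eta Z * B X xi.
Hypothesis A_phi : forall X Y Z,
  A X (phi Y) Z - A X Y (phi Z) = B X Y * eta Z + eta Y * B X Z.
Hypothesis A_normal : forall X Y Z,
  A (phi X) Y Z - A (phi Y) X Z - A Y X (phi Z) + A X Y (phi Z)
  + (B X Y - B Y X) * eta Z = 0.
Hypothesis B_skew : forall X Y, B X Y = - B Y X.

Lemma B_xi1 X : B xi X = 0.
Proof. by rewrite B_skew B_xi oppr0. Qed.

(** In normality paired with [xi], the terms containing [phi xi] vanish and the others are values of
    B; skewness of B doubles both sides. *)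
Lemma B_phi_invariant X Y : B (phi X) (phi Y) = B X Y.
Proof.
have := A_normal X Y xi.
rewrite !A_phi_xi3 eta_xi (A_skew (phi X)) (A_skew (phi Y)) !A_xi.
have := B_skew (phi X) (phi Y); have := B_skew X Y; lra.
Qed.

Lemma B_phi_skew X Y : B (phi X) Y = - B X (phi Y).
Proof.
have := B_phi_invariant X (phi Y); rewrite B_phi2 B_xi; lra.
Qed.

(** Normality at (X, xi, W) gives A(xi, X, phi W) = 0. Any Z is -phi^2 Z + eta(Z) xi, and A(xi, X,
    xi) = -B(xi, phi X) = 0. *)
Lemma A_xi1 X Z : A xi X Z = 0.
Proof.
have Aphi W : A xi X (phi W) = 0.
  have := A_normal X xi W.
  rewrite A_phi_xi1 !A_xi B_phi_invariant B_phi2 B_xi B_xi1; lra.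
have := A_phi2_3 xi X Z.
rewrite Aphi (A_skew xi X xi) A_xi B_xi1; lra.
Qed.

(* T(X,Y,Z) = A(phi X,Y,Z) + A(X,Y,phi Z) is, up to terms in B and eta,
   symmetric in (X,Y) by normality and skew in (Y,Z), hence determined by
   those terms. *)
Lemma A_phi_normal X Y Z : A (phi X) Y Z + A X Y (phi Z) = - B X Y * eta Z.
Proof.
pose T X Y Z := A (phi X) Y Z + A X Y (phi Z).
have Tsym P Q S : T P Q S = T Q P S - 2 * B P Q * eta S.
  by rewrite /T; have := A_normal P Q S; rewrite (B_skew Q P); lra.
have Tskew P Q S : T P Q S = - T P S Q - B P Q * eta S - eta Q * B P S.
  rewrite /T (A_skew (phi P) Q) (A_skew P S (phi Q)).
  by have := A_phi P Q S; lra.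
rewrite -/(T X Y Z).
(* Alternating the two transpositions, three times each, returns to (X,Y,Z) with the sign reversed,
   so 2T is left as terms in B and eta. *)
have := Tsym X Y Z; have := Tskew Y X Z; have := Tsym Y Z X.
have := Tskew Z Y X; have := Tsym Z X Y; have := Tskew X Z Y.
rewrite (B_skew Y X) (B_skew Z Y) (B_skew Z X); lra.
Qed.

(** For nabla = D + c/2 the left side is g((nabla_X phi)Y, Z), since phi is skew for g. *)
Lemma torsion_tensor_cov_phi X Y Z :
  A X Y Z + 2^-1 * (torsion_tensor X (phi Y) Z + torsion_tensor X Y (phi Z)) = 0.
Proof.
(* The auxiliary identities serve to strip phi from the arguments two at a time, at the cost of
   terms in B and eta. *)
have A13 P Q S : A (phi P) Q (phi S) = A P Q S - B (phi P) Q * eta S.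
  by have := A_phi_normal (phi P) Q S; rewrite A_phi2_1 A_xi1; lra.
have A12 P Q S : A (phi P) (phi Q) S = A P Q S + B (phi P) S * eta Q.
  by rewrite A_skew A13 (A_skew P S); lra.
have A23 P Q S : A P (phi Q) (phi S) =
    - A P Q S - eta S * B P (phi Q) + eta Q * B P (phi S).
  have := A_phi P Q (phi S).
  by rewrite eta_phi A_phi2_3 (A_skew P Q xi) A_xi; lra.
have Axi3 P Q : A P Q xi = - B P (phi Q) by rewrite A_skew A_xi.
have Bphi2 P Q : B P (phi (phi Q)) = - B P Q by rewrite B_phi2 B_xi; lra.
have A12phi2 P Q S : A (phi P) (phi Q) (phi (phi S)) =
    - A P Q S - B (phi P) S * eta Q + eta S * B (phi P) Q.
  by rewrite A_phi2_3 A12 Axi3 Bphi2; lra.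
have A1phi2 P Q S : A (phi (phi P)) (phi Q) (phi S) =
    A P Q S + eta S * B P (phi Q) - eta Q * B P (phi S).
  by rewrite A_phi2_1 A_xi1 A23; lra.
(* Up to B and eta, the A-terms led by Y and by Z cancel between the two values of c, and those led
   by X add up to -2 A(X,Y,Z). *)
rewrite /torsion_tensor !eta_phi (A_skew (phi X) (phi (phi Y))) !A12phi2 !A1phi2.
rewrite (A_skew (phi Y) (phi (phi Z))) !A12phi2 (A_skew Y Z X) (A_skew X Z Y).
have Bsym P Q : B P (phi Q) = B Q (phi P).
  by rewrite B_skew B_phi_skew opprK.
rewrite !B_phi_skew (Bsym Y X) (Bsym Z X) (Bsym Z Y).
lra.
Qed.
End NormalTensorAlgebra.

(** * Rules for derivatives, metric and endomorphisms over smooth functions *)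

Section VectorFieldCalculus.
Context {R : realType} {n : nat} {N : smooth_manifold R n}.
Variables (g : riemannian_metric N).
Implicit Types (X Y Z : vector_field N) (f h : smooth_fun N).

Lemma smooth_fun_eq f h : (forall p, f p = h p) -> f = h.
Proof. by move=> fh; apply/val_inj/funext. Qed.

Lemma lie_funD X f h : lie_fun X (f + h) = lie_fun X f + lie_fun X h.
Proof. by have := lie_fun_linear X 1 f h; rewrite !scale1r. Qed.

Lemma lie_fun0 X : lie_fun X 0 = 0.
Proof.
by have := lie_fun_linear X (-1) 0 0; rewrite scaler0 addr0 scaleN1r addNr.
Qed.

Lemma lie_funN X f : lie_fun X (- f) = - lie_fun X f.
Proof.
by have := lie_fun_linear X (-1) f 0; rewrite !scaleN1r lie_fun0 !addr0.
Qed.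

Lemma lie_fun1 X : lie_fun X 1 = 0.
Proof.
have := lie_funM X 1 1; rewrite mulr1 mul1r => /eqP.
by rewrite -[X in X == _]addr0 (inj_eq (addrI _)) eq_sym => /eqP.
Qed.

Lemma metricC X Y : g X Y = g Y X.
Proof. by apply: smooth_fun_eq => p /=; rewrite Defs.metric_sym. Qed.

Lemma metricPl f X Y Z : g (f *: X + Y) Z = f * g X Z + g Y Z.
Proof. by apply: smooth_fun_eq => p /=; rewrite metric_linear. Qed.

Lemma metricDl X Y Z : g (X + Y) Z = g X Z + g Y Z.
Proof. by have := metricPl 1 X Y Z; rewrite scale1r mul1r. Qed.

Lemma metric0l Z : g 0 Z = 0.
Proof. by have := metricPl (-1) 0 0 Z; rewrite scaler0 addr0 mulN1r addNr. Qed.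

Lemma metricZl f X Z : g (f *: X) Z = f * g X Z.
Proof. by have := metricPl f X 0 Z; rewrite metric0l !addr0. Qed.

Lemma metricNl X Z : g (- X) Z = - g X Z.
Proof. by have := metricZl (-1) X Z; rewrite scaleN1r mulN1r. Qed.

Lemma metricDr X Y Z : g Z (X + Y) = g Z X + g Z Y.
Proof. by rewrite metricC metricDl !(metricC Z). Qed.

Lemma metric0r Z : g Z 0 = 0.
Proof. by rewrite metricC metric0l. Qed.

Lemma metricZr f X Z : g Z (f *: X) = f * g Z X.
Proof. by rewrite metricC metricZl (metricC Z). Qed.

Lemma metricNr X Z : g Z (- X) = - g Z X.
Proof. by rewrite metricC metricNl (metricC Z). Qed.

Definition metricE :=
  (metricDl, metricNl, metricZl, metric0l,
   metricDr, metricNr, metricZr, metric0r).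

(** The choice Z = X - Y gives g(X - Y, X - Y) = 0, and positive definiteness applies at each
    point. *)
Lemma metric_nondegenerate X Y : (forall Z, g X Z = g Y Z) -> X = Y.
Proof.
move=> XY; apply: vector_fieldP => p; apply/eqP; rewrite -subr_eq0.
apply/negPn/negP => /(Defs.metric_pos g) /=.
have /(congr1 (fun f : smooth_fun N => f p)) /= : g (X - Y) (X - Y) = 0.
  by rewrite !metricE !XY; ring.
by move=> ->; rewrite ltxx.
Qed.

Lemma endoP (phi : bundle_endomorphism N) f X Y :
  phi (f *: X + Y) = f *: phi X + phi Y.
Proof. by apply: vector_fieldP => p /=; rewrite endo_linear. Qed.

Lemma endoD (phi : bundle_endomorphism N) X Y : phi (X + Y) = phi X + phi Y.
Proof. by have := endoP phi 1 X Y; rewrite !scale1r. Qed.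

Lemma endo0 (phi : bundle_endomorphism N) : phi 0 = 0.
Proof. by have := endoP phi (-1) 0 0; rewrite scaler0 addr0 scaleN1r addNr. Qed.

Lemma endoZ (phi : bundle_endomorphism N) f X : phi (f *: X) = f *: phi X.
Proof. by have := endoP phi f X 0; rewrite endo0 !addr0. Qed.

Lemma endoN (phi : bundle_endomorphism N) X : phi (- X) = - phi X.
Proof. by have := endoZ phi (-1) X; rewrite !scaleN1r. Qed.

Definition endoE := (endoD, endoN, endoZ, endo0).

End VectorFieldCalculus.

(** * Levi-Civita formulas for A, B, the normality tensor and c *)

Section LeviCivita.
Set Implicit Arguments.
Context {R : realType} {n : nat} {N : smooth_manifold R n}.
Variables (g : riemannian_metric N) (xi : vector_field N).
Variables (eta : one_form N) (phi : bundle_endomorphism N).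
Variable D : vector_field N -> vector_field N -> vector_field N.
Hypothesis acm : almost_contact_metric g xi eta phi.
Hypothesis D_LC : is_levi_civita g D.
Implicit Types (X Y Z : vector_field N) (f : smooth_fun N).

Let A X Y Z : smooth_fun N := g (cov_endo D phi X Y) Z.
Let B X Y : smooth_fun N := g (D X xi) Y.

Lemma etaE X : eta X = g xi X.
Proof. by apply: smooth_fun_eq => p; exact: (acm_dual acm). Qed.

Lemma metric_xi : g xi xi = 1.
Proof. by apply: smooth_fun_eq => p; exact: (acm_unit acm). Qed.

Lemma eta_xi : eta xi = 1.
Proof. by rewrite etaE metric_xi. Qed.

Lemma phi_xi : phi xi = 0.
Proof. by apply: vector_fieldP => p; exact: (acm_phi_xi acm). Qed.

Lemma phi_phi X : phi (phi X) = - X + eta X *: xi.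
Proof. by apply: vector_fieldP => p; exact: (acm_phi2 acm). Qed.

Lemma metric_phi_phi X Y : g (phi X) (phi Y) = g X Y - eta X * eta Y.
Proof. by apply: smooth_fun_eq => p; exact: (acm_compat acm). Qed.

(** Computing phi^3 X in two ways leaves eta(phi X) xi = 0, and [xi] has unit norm. *)
Lemma eta_phi X : eta (phi X) = 0.
Proof.
have := phi_phi (phi X).
rewrite [X in phi X]phi_phi !endoE phi_xi scaler0 addr0 => /eqP.
rewrite -[X in X == _]addr0 (inj_eq (addrI _)) eq_sym => /eqP.
by move=> /(congr1 (g xi)); rewrite !metricE metric_xi mulr1.
Qed.

Lemma metric_phi_skew X Y : g (phi X) Y = - g X (phi Y).
Proof.
have := metric_phi_phi X (phi Y).
rewrite phi_phi eta_phi !metricE (metricC g (phi X) xi) -(etaE (phi X)) eta_phi.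
by rewrite !mulr0 subr0 addr0 => <-; rewrite opprK.
Qed.

Lemma LC_Dl X X' Y : D (X + X') Y = D X Y + D X' Y.
Proof. by have [[l _ _] _ _] := D_LC; have := l Y 1 X X'; rewrite /= !scale1r. Qed.

Lemma LC_0l Y : D 0 Y = 0.
Proof.
have [[l _ _] _ _] := D_LC; have := l Y (-1) 0 0.
by rewrite /= scaler0 addr0 scaleN1r addNr.
Qed.

Lemma LC_Zl f X Y : D (f *: X) Y = f *: D X Y.
Proof.
by have [[l _ _] _ _] := D_LC; have := l Y f X 0; rewrite /= LC_0l !addr0.
Qed.

Lemma LC_Nl X Y : D (- X) Y = - D X Y.
Proof. by have := LC_Zl (-1) X Y; rewrite !scaleN1r. Qed.

Lemma LC_Dr X Y Y' : D X (Y + Y') = D X Y + D X Y'.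
Proof. by have [[_ a _] _ _] := D_LC; exact: a. Qed.

Lemma LC_leibniz X f Y : D X (f *: Y) = lie_fun X f *: Y + f *: D X Y.
Proof. by have [[_ _ z] _ _] := D_LC; exact: z. Qed.

Lemma LC_0r X : D X 0 = 0.
Proof. by have := LC_leibniz X 0 0; rewrite !scaler0 scale0r addr0. Qed.

Lemma LC_Nr X Y : D X (- Y) = - D X Y.
Proof.
have := LC_leibniz X (-1) Y.
by rewrite !scaleN1r lie_funN lie_fun1 oppr0 scale0r add0r.
Qed.

Lemma lie_fun_metric X Y Z : lie_fun X (g Y Z) = g (D X Y) Z + g Y (D X Z).
Proof.
have [_ m _] := D_LC; have := m X Y Z; rewrite /cov_metric => /eqP.
by rewrite -addrA -opprD subr_eq0 => /eqP.
Qed.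

Lemma lie_bracketE X Y : lie_bracket X Y = D X Y - D Y X.
Proof.
by have [_ _ t] := D_LC; have /eqP := t X Y; rewrite subr_eq0 => /eqP ->.
Qed.

Lemma cov_phi_linear1 f X X' Y Z : A (f *: X + X') Y Z = f * A X Y Z + A X' Y Z.
Proof.
by rewrite /A /cov_endo !LC_Dl !LC_Zl !endoE !metricE; ring.
Qed.

Lemma cov_phi_linear3 f X Y Z Z' : A X Y (f *: Z + Z') = f * A X Y Z + A X Y Z'.
Proof. by rewrite /A !metricE; ring. Qed.

(** Derivative along X of g(phi Y, Z) = -g(phi Z, Y), with Dg = 0. *)
Lemma cov_phi_skew X Y Z : A X Y Z = - A X Z Y.
Proof.
have : lie_fun X (g (phi Y) Z) = - lie_fun X (g (phi Z) Y).
  by rewrite -lie_funN metric_phi_skew (metricC g Y).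
rewrite /A /cov_endo !lie_fun_metric !metricE !(metric_phi_skew (D _ _)).
rewrite (metricC g (phi Y)) (metricC g (phi Z)) => h.
apply/eqP; rewrite -addr_eq0; apply/eqP.
move/eqP: h; rewrite -addr_eq0 => /eqP <-; ring.
Qed.

Lemma cov_phi_linear2 f X Y Y' Z : A X (f *: Y + Y') Z = f * A X Y Z + A X Y' Z.
Proof.
by rewrite !(cov_phi_skew X _ Z) cov_phi_linear3; ring.
Qed.

Lemma cov_xi_linear1 f X X' Y : B (f *: X + X') Y = f * B X Y + B X' Y.
Proof. by rewrite /B LC_Dl LC_Zl !metricE. Qed.

Lemma cov_xi_linear2 f X Y Y' : B X (f *: Y + Y') = f * B X Y + B X Y'.
Proof. by rewrite /B !metricE. Qed.

Lemma cov_phi_xi X Z : A X xi Z = B X (phi Z).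
Proof.
by rewrite /A /cov_endo phi_xi LC_0r !metricE metric_phi_skew add0r opprK.
Qed.

(** The derivative of the constant g(xi, xi) = 1 is 2 B(X, xi). *)
Lemma cov_xi_xi X : B X xi = 0.
Proof.
have := lie_fun_metric X xi xi.
rewrite metric_xi lie_fun1 (metricC g xi) -/(B X xi) -mulr2n -scaler_nat.
move=> /(congr1 ( *:%R (2^-1 : R))).
by rewrite scaler0 scalerA mulVf ?scale1r // pnatr_eq0.
Qed.

(** Covariant derivative along X of phi^2 = -1 + eta (x) xi, applied to Y and paired with Z. *)
Lemma cov_phi_phi X Y Z :
  A X (phi Y) Z - A X Y (phi Z) = B X Y * eta Z + eta Y * B X Z.
Proof.
rewrite /A /B /cov_endo !metricE !metric_phi_skew !phi_phi LC_Dr LC_Nr LC_leibniz.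
rewrite (etaE Y) lie_fun_metric !metricE -!etaE.
rewrite (metricC g (D X Y) xi) -etaE; ring.
Qed.

(** Torsion-freeness replaces each bracket by D; derivatives of phi X and phi Y give A, d eta gives
    B, and the remaining derivatives of X and Y cancel. *)
Lemma normality_cov X Y Z :
  g (normality_tensor xi eta phi X Y) Z =
  A (phi X) Y Z - A (phi Y) X Z - A Y X (phi Z) + A X Y (phi Z)
  + (B X Y - B Y X) * eta Z.
Proof.
rewrite /normality_tensor /ext_d1 !etaE !lie_fun_metric !lie_bracketE /A /B /cov_endo.
rewrite !endoE !metricE !metric_phi_skew; ring.
Qed.

Lemma ext_d1_eta X Y : ext_d1 eta X Y = B X Y - B Y X.
Proof.
by rewrite /ext_d1 !etaE !lie_fun_metric !lie_bracketE /B !metricE; ring.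
Qed.

(** A(X,Y,Z) = (D_X F)(Y,Z), and for a torsion-free connection dF is the cyclic sum of DF. *)
Lemma ext_d2_fundamental_form X Y Z :
  ext_d2 (fundamental_form g phi) X Y Z = A X Y Z + A Y Z X + A Z X Y.
Proof.
rewrite (cov_phi_skew Y Z X) /ext_d2 /fundamental_form !lie_fun_metric !lie_bracketE.
rewrite /A /cov_endo !endoE !metricE !(metric_phi_skew (D _ _)).
rewrite !(metricC g (D _ _) (phi _)); ring.
Qed.

Lemma torsion_formE X Y Z :
  torsion_form g eta phi X Y Z =
  eta X * (B Y Z - B Z Y) - eta Y * (B X Z - B Z X) + eta Z * (B X Y - B Y X)
  + (A (phi X) (phi Y) (phi Z) + A (phi Y) (phi Z) (phi X)
     + A (phi Z) (phi X) (phi Y)).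
Proof.
by rewrite /torsion_form /wedge12 /ext_dphi2 ext_d2_fundamental_form !ext_d1_eta.
Qed.

Lemma torsion_form_skew X Y Z :
  torsion_form g eta phi X Y Z = - torsion_form g eta phi X Z Y.
Proof.
rewrite !torsion_formE (cov_phi_skew (phi X) (phi Z)).
by rewrite (cov_phi_skew (phi Y) (phi X)) (cov_phi_skew (phi Z) (phi Y)); ring.
Qed.

(** Linearity of c over smooth functions is what keeps nabla = D + c/2 a connection. *)
Lemma torsion_form_linear1 f X X' Y Z :
  torsion_form g eta phi (f *: X + X') Y Z =
  f * torsion_form g eta phi X Y Z + torsion_form g eta phi X' Y Z.
Proof.
rewrite !torsion_formE !endoP !etaE cov_phi_linear1 cov_phi_linear2 cov_phi_linear3.
by rewrite !cov_xi_linear1 !cov_xi_linear2 !metricE; ring.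
Qed.

Lemma torsion_form_linear2 f X Y Y' Z :
  torsion_form g eta phi X (f *: Y + Y') Z =
  f * torsion_form g eta phi X Y Z + torsion_form g eta phi X Y' Z.
Proof.
rewrite !torsion_formE !endoP !etaE cov_phi_linear1 cov_phi_linear2 cov_phi_linear3.
by rewrite !cov_xi_linear1 !cov_xi_linear2 !metricE; ring.
Qed.

(** Together with [torsion_form_skew] this makes c totally skew; that lemma serves nabla g = 0, this
    one the converse direction. *)
Lemma torsion_form_skew13 X Y Z :
  torsion_form g eta phi X Y Z = - torsion_form g eta phi Z Y X.
Proof.
rewrite !torsion_formE (cov_phi_skew (phi X) (phi Y)).
by rewrite (cov_phi_skew (phi Y) (phi Z)) (cov_phi_skew (phi Z) (phi X)); ring.
Qed.

(** The D_xi terms cancel by Dg = 0, so [xi] is Killing exactly when B is skew. *)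
Lemma lie_metric_xi Y Z : lie_metric g xi Y Z = B Y Z + B Z Y.
Proof.
rewrite /lie_metric lie_fun_metric !lie_bracketE /B !metricE (metricC g Y (D Z xi)).
ring.
Qed.

(** An identity of smooth functions is checked at each point p, where the values of A, B and eta lie
    in the ordered field [R] and the abstract algebra applies. *)
Lemma killing_cov_phi :
  (forall X Y, normality_tensor xi eta phi X Y = 0) -> is_killing g xi ->
  forall X Y Z, A X Y Z + 2^-1 *: (torsion_form g eta phi X (phi Y) Z
                                   + torsion_form g eta phi X Y (phi Z)) = 0.
Proof.
move=> normal killing X Y Z; apply: smooth_fun_eq => p.
have at_p (f h : smooth_fun N) : f = h -> f p = h p by move=> ->.
rewrite !torsion_formE.
apply: (@torsion_tensor_cov_phi R (vector_field N)
  (fun X Y Z => A X Y Z p) (fun X Y => B X Y p) (fun X => eta X p) phi xi).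
- exact: at_p eta_xi.
- by move=> U; exact: at_p (eta_phi U).
- by move=> U V W; exact: at_p (cov_phi_skew U V W).
- move=> V W; apply: (at_p _ 0).
  by rewrite phi_xi /A /cov_endo !LC_0l endo0 subr0 metric0l.
- by move=> U V; apply: (at_p _ 0); rewrite phi_xi /A metric0r.
- by move=> U W; exact: at_p (cov_phi_xi U W).
- move=> U V W; apply: (at_p _ (- A U V W + eta U * A xi V W)).
  by rewrite phi_phi /A /cov_endo !LC_Dl !LC_Nl !LC_Zl !endoE !metricE; ring.
- move=> U V W; apply: (at_p _ (- A U V W + eta W * A U V xi)).
  by rewrite phi_phi /A !metricE; ring.
- by move=> U; exact: at_p (cov_xi_xi U).
- move=> U W; apply: (at_p _ (- B U W + eta W * B U xi)).
  by rewrite phi_phi /B !metricE; ring.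
- by move=> U V W; exact: at_p (cov_phi_phi U V W).
- move=> U V W; have := at_p _ _ (normality_cov U V W).
  by rewrite normal metric0l => /esym.
- move=> U V; have := killing U V; rewrite lie_metric_xi => /eqP.
  by rewrite addr_eq0 => /eqP; exact: at_p.
Qed.

End LeviCivita.

(** * The Killing condition against the properties of nabla *)

Theorem proposition2p3 (R : realType) (n : nat) (N : smooth_manifold R n)
    (g : riemannian_metric N) (xi : vector_field N) (eta : one_form N)
    (phi : bundle_endomorphism N)
    (Hnormal : normal_acm g xi eta phi)
    (nablaLC : vector_field N -> vector_field N -> vector_field N)
    (HLC : is_levi_civita g nablaLC)
    (nabla : vector_field N -> vector_field N -> vector_field N)
    (Hnabla : forall X Y Z : vector_field N,
        g (nabla X Y) Z =
        g (nablaLC X Y) Z + 2^-1 *: torsion_form g eta phi X Y Z) :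
  ST_manifold g xi eta phi <-> acm_connection g xi phi nabla.
Proof.
have [acm normal] := Hnormal.
pose c := torsion_form g eta phi.
(* The factor 1/2 is a real scalar and f a smooth function; this lets linearity of c pass to c/2. *)
have half (f h k : smooth_fun N) :
    2^-1 *: (f * h + k) = f * (2^-1 *: h) + 2^-1 *: k.
  by rewrite scalerDr; congr (_ + _); apply: smooth_fun_eq => p; exact: mulrCA.
(* Every A-term of c(X, xi, Z) has phi xi = 0 as an argument, so only B and eta are left. *)
have c_xi X Z : c X xi Z = eta X * (g (nablaLC xi xi) Z - g (nablaLC Z xi) xi)
    - (g (nablaLC X xi) Z - g (nablaLC Z xi) X)
    + eta Z * (g (nablaLC X xi) xi - g (nablaLC xi xi) X).
  rewrite /c (torsion_formE acm HLC) (phi_xi acm) (eta_xi acm) /cov_endo.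
  by rewrite !endo0 !(LC_0l HLC) !(LC_0r HLC) !endo0 !metricE; ring.
split=> [[_ killing]|[_ _ nabla_xi _]]; last first.
  split=> // Y Z; rewrite (lie_metric_xi _ HLC).
  have e X W : g (nablaLC X xi) W = - (2^-1 *: c X xi W).
    apply/eqP; rewrite -addr_eq0; apply/eqP.
    by rewrite -Hnabla nabla_xi metric0l.
  rewrite !e /c [torsion_form _ _ _ Z _ _](torsion_form_skew13 acm HLC).
  by rewrite scalerN opprK addNr.
split.
- split=> [Y f X X'|X Y Y'|X f Y]; apply: (@metric_nondegenerate _ _ _ g) => Z.
  + rewrite metricPl !Hnabla (torsion_form_linear1 acm HLC) half.
    by rewrite (LC_Dl HLC) (LC_Zl HLC) !metricE; ring.
  + rewrite metricDl !Hnabla -[X in torsion_form _ _ _ _ (X + _) _]scale1r.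
    rewrite (torsion_form_linear2 acm HLC) half mul1r (LC_Dr HLC) metricDl; ring.
  (* Adding 0 puts f Y in the form covered by [torsion_form_linear2], which leaves c(X, 0, Z) = 0 to
     show. *)
  + rewrite !metricE !Hnabla -[X in torsion_form _ _ _ _ X _]addr0.
    rewrite (torsion_form_linear2 acm HLC).
    have -> : torsion_form g eta phi X 0 Z = 0.
      have := torsion_form_linear2 acm HLC (-1) X 0 0 Z.
      by rewrite scaler0 addr0 mulN1r addNr.
    by rewrite half scaler0 (LC_leibniz HLC) !metricE; ring.
- move=> X Y Z; rewrite /cov_metric (lie_fun_metric HLC) (metricC g Y (nabla _ _)).
  rewrite !Hnabla (torsion_form_skew acm HLC X Z Y) scalerN.
  rewrite (metricC g Y); ring.
- move=> X; apply: (@metric_nondegenerate _ _ _ g) => Z.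
  have skew V W : g (nablaLC V xi) W = - g (nablaLC W xi) V.
    apply/eqP; rewrite -addr_eq0; have := killing V W.
    by rewrite (lie_metric_xi _ HLC) => ->.
  have xi0 V : g (nablaLC xi xi) V = 0 by rewrite skew (cov_xi_xi acm HLC) oppr0.
  have -> : g (nabla X xi) Z = g (nablaLC X xi) Z + 2^-1 *: c X xi Z by [].
  (* With B skew and B vanishing whenever one argument is [xi], c(X, xi, Z) is -2 B(X,Z), and half
     of it cancels B(X,Z). *)
  rewrite c_xi !xi0 !(cov_xi_xi acm HLC) (skew Z X) metric0l.
  rewrite !subr0 !mulr0 sub0r addr0 opprK -mulr2n scalerN -scalerMnr scalerMnl.
  by rewrite -mulr_natr mulVf ?scale1r ?subrr // pnatr_eq0.
- move=> X Y; apply: (@metric_nondegenerate _ _ _ g) => Z.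
  have := killing_cov_phi acm HLC normal killing X Y Z.
  rewrite metric0l /cov_endo !metricE !(metric_phi_skew acm) !Hnabla scalerDr => <-.
  by ring.
Qed.
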